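(* Let $X$ be an infinite regular cardinal. For $n\ge 2$ let $\mathscr{M}_n=\langle\{m_2^n\}\cup T_1\rangle$. The sequence $(\mathscr{M}_n)_{n\ge 2}$ forms a countably infinite descending chain: $$\mathscr{O}=\mathscr{M}_2\supsetneq\mathscr{M}_3=Pol(T_1)\supsetneq\mathscr{M}_4\supsetneq\dots\supsetneq\mathscr{M}_n\supsetneq\mathscr{M}_{n+1}\supsetneq\dots$$ Moreover, $\bigcap_{n\ge 2}\mathscr{M}_n=\mathscr{U}$.
   Context: $X$ is an infinite regular cardinal with its usual well-order. $\mathscr{O}^{(n)}$ is the set of all functions $X^n\to X$ and $\mathscr{O}=\bigcup_{n\ge 1}\mathscr{O}^{(n)}$. A clone over $X$ is a subset of $\mathscr{O}$ containing all projections and closed under composition. For $\mathscr{F}\subseteq\mathscr{O}$, $\langle\mathscr{F}\rangle$ is the smallest clone containing $\mathscr{F}$. A function $f\in\mathscr{O}^{(n)}$ is almost unary iff there are $F\in\mathscr{O}^{(1)}$ and $1\le k\le n$ with $f(x_1,\dots,x_n)<F(x_k)$ for all $(x_1,\dots,x_n)\in X^n$. $\mathscr{U}$ is the set of all almost unary functions, and $T_1$ is the set of all binary almost unary functions. $Pol(T_1)$ is the set of all $f\in\mathscr{O}$ (of any arity $n$) such that for all $g_1,\dots,g_n\in T_1$ the composite $f(g_1,\dots,g_n)$ is in $T_1$. For $1\le k\le n$, $m^n_k\in\mathscr{O}^{(n)}$ is defined by $m^n_k(x_1,\dots,x_n)=x_{j_k}$ if $x_{j_1}\le\dots\le x_{j_n}$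 with $\{j_1,\dots,j_n\}=\{1,\dots,n\}$ (the $k$-th smallest entry). *)

(* Defs.v *)
From mathcomp Require Import all_boot all_order all_fingroup.
From mathcomp Require Import mathcomp_extra boolp classical_sets functions.
From mathcomp Require Import cardinality wochoice.

Set Implicit Arguments.
Unset Strict Implicit.
Unset Printing Implicit Defensive.

Local Open Scope classical_set_scope.
Local Open Scope card_scope.
Local Open Scope order_scope.

(* The order of X is that of an initial ordinal (every proper initial segment
   is smaller than X) equal to its own cofinality (every cofinal subset has
   the cardinality of X). *)
Definition infinite_regular_cardinal (d : Order.disp_t) (X : orderType d) :=
  [/\ infinite_set [set: X],
      well_order (fun x y : X => x <= y),
      forall x : X, ~ ([set: X] #<= [set y : X | y < x]) &
      forall A : set X, (forall x, exists2 a, A a & x <= a) -> [set: X] #<= A].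

Section Operations.
Variable X : Type.

Definition opn (n : nat) := n.-tuple X -> X.

(* [fop] also contains the nullary operations; they are left out of
   [cloneO]. *)
Definition fop := {n : nat & opn n}.
Definition op (n : nat) (f : opn n) : fop := existT opn n f.

Definition cloneO : set fop := [set f | (0 < tag f)%N].

Definition proj_op (n : nat) (k : 'I_n) : opn n := fun x => tnth x k.

Definition comp_op (n m : nat) (f : opn n) (g : 'I_n -> opn m) : opn m :=
  fun x => f [tuple g i x | i < n].

Definition is_clone (C : set fop) :=
  [/\ C `<=` cloneO,
      forall (n : nat) (k : 'I_n), C (op (proj_op k)) &
      forall (n m : nat) (f : opn n) (g : 'I_n -> opn m),
        C (op f) -> (forall i, C (op (g i))) -> C (op (comp_op f g))].

Definition clone_gen (F : set fop) : set fop := smallest is_clone F.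

Definition Pol (G : set (opn 2)) : set fop :=
  [set f | cloneO f /\ forall g : 'I_(tag f) -> opn 2,
             (forall i, G (g i)) -> G (comp_op (tagged f) g)].

End Operations.

Arguments cloneO X : clear implicits.

Section AlmostUnary.
Variables (d : Order.disp_t) (X : orderType d).

Definition almost_unary (n : nat) (f : opn X n) :=
  exists (F : X -> X) (k : 'I_n), forall x : n.-tuple X, f x < F (tnth x k).

Definition cloneU : set (fop X) :=
  [set f | cloneO X f /\ almost_unary (tagged f)].

Definition T1 : set (opn X 2) := [set f | almost_unary f].

(* Indices start at 0: this is m^n_(k+1). *)
Definition mstat (n : nat) (k : 'I_n) : opn X n :=
  fun x => tnth (sort_tuple (fun a b : X => a <= b) x) k.

Lemma mstatP (n : nat) (k : 'I_n) (x : n.-tuple X) (j : 'S_n) :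
  (forall a b : 'I_n, (a <= b)%N -> tnth x (j a) <= tnth x (j b)) ->
  mstat k x = tnth x (j k).
Proof.
move=> jx; pose t := [tuple tnth x (j i) | i < n].
have -> : tnth x (j k) = tnth t k by rewrite /t tnth_mktuple.
suff e : sort_tuple (fun a b : X => a <= b) x = t by rewrite /mstat e.
apply: val_inj; apply: (@Order.POrderTheory.le_sorted_eq _ X).
- exact/sort_sorted/Order.TotalTheory.le_total.
- apply/(sortedP (tnth x k)) => i; rewrite size_tuple => lt_i.
  rewrite -(tnth_nth _ t (Ordinal (ltnW lt_i))) -(tnth_nth _ t (Ordinal lt_i)).
  by rewrite /t !tnth_mktuple; exact/jx/leqnSn.
- by rewrite perm_sort perm_sym; apply/tuple_permP; exists j.
Qed.

(* M_n, meaningful for n >= 2; the set on the left is {m^n_2}. *)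
Definition cloneM (n : nat) : set (fop X) :=
  clone_gen ([set op (mstat k) | k in [set k : 'I_n | k = 1%N :> nat]] `|`
             [set op f | f in T1]).

End AlmostUnary.

Arguments cloneU {d} X.
Arguments T1 {d} X.
Arguments cloneM {d} X n.

(* Main.v *)
(* Call a set A of coordinates of f strong if f is bounded on every set of
   arguments whose coordinates in A are bounded, and weak otherwise. Regularity
   makes f almost unary iff some singleton is strong. Let C_r be the set of the
   operations whose coordinates are not covered by r weak sets, equivalently
   such that every colouring of the coordinates with r colours has a strong
   class; C_r is a clone. The weak sets of m^n_2 are those with at most one
   element, so m^n_2 lies in C_(n-1) but not in C_n, and M_n is contained in
   C_(n-1).

   Conversely let f be in C_(n-1). If all but one of the arguments of
   m^n_2 are at least y, then so is its value; hence a Baker-Pixley induction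
   gives a term t in m^n_2 alone such that, for every x and every weak W, some
   x_i with i outside W is at most t(x). Then the set of all i with
   x_i <= t(x) is strong, so f(x) <= F(t(x)) for a unary F. Finally, every
   operation below a member of a clone containing T_1 is in that clone. *)
Require Import Defs.
From mathcomp Require Import all_boot all_order all_fingroup.
From mathcomp Require Import boolp classical_sets cardinality wochoice.

Set Implicit Arguments.
Unset Strict Implicit.
Unset Printing Implicit Defensive.

Import Order.TTheory.
Local Open Scope classical_set_scope.
Local Open Scope card_scope.
Local Open Scope order_scope.

(** * Bounds from regularity, and a pairing bounded by its first argument *)

Section RegularCardinal.
Variables (d : Order.disp_t) (X : orderType d).
Hypothesis hX : infinite_regular_cardinal X.

Lemma point_exists : exists x : X, True.
Proof.
have [infX _ _ _] := hX.
by apply: contrapT => nX; apply: infX; rewrite (_ : setT = set0);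
  [exact: finite_set0 | apply/seteqP; split=> // x _; apply: nX; exists x].
Qed.

Lemma well_order_min (P : X -> Prop) :
  (exists x, P x) -> exists2 z, P z & forall x, P x -> z <= x.
Proof.
have [_ wo _ _] := hX => -[x Px].
have [|z [[/asboolP Pz zP] _]] := wo (fun x => `[< P x >]).
  by exists x; exact/asboolP.
by exists z => // y Py; apply: zP; exact/asboolP.
Qed.

Lemma least_exists : exists z : X, forall x, z <= x.
Proof.
by have [z _ zP] := well_order_min point_exists; exists z => x; exact: zP.
Qed.

Lemma lt_wf : well_founded (fun x y : X => x < y).
Proof.
move=> x; apply: contrapT => nx.
have [z nz zP] := well_order_min (ex_intro (fun x => ~ Acc _ x) x nx).
apply: nz; constructor => y yz; apply: contrapT => /zP.
by rewrite leNgt yz.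
Qed.

Lemma gt_exists (b : X) : exists c, b < c.
Proof.
have [infX _ _ cof] := hX.
apply: contrapT => nb; apply: infX.
apply: (card_le_finite (B := [set b])); last exact: finite_set1.
apply: cof => x; exists b => //; rewrite leNgt; apply/negP => bx.
by apply: nb; exists x.
Qed.

(** The segment up to [b] is smaller than [X], hence so is its image, which by regularity cannot be
    cofinal. *)
Lemma image_bounded (F : X -> X) (b : X) :
  exists e, forall a, a <= b -> F a <= e.
Proof.
have [_ _ card cof] := hX; apply: contrapT => nF.
have [c bc] := gt_exists b; apply: (card c).
have : [set: X] #<= (F @` [set a | a <= b]).
  apply: cof => x; apply: contrapT => nx; apply: nF; exists x => a ab.
  by rewrite leNgt; apply/negP => xa; apply: nx;
    exists (F a); [exists a | exact: ltW].
move=> /card_le_trans; apply.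
apply: card_le_trans (card_image_le _ _) _; apply: subset_card_le => a /= ab.
exact: le_lt_trans ab bc.
Qed.

Lemma finite_bounded (I : finType) (F : I -> X) : exists e, forall i, F i <= e.
Proof.
have [z _] := least_exists.
by exists (\big[Order.max/z]_i F i) => i; exact: le_bigmax.
Qed.

Lemma box_bounded (k : nat) (f : opn X k) (b : X) :
  exists e, forall x : k.-tuple X, (forall i, tnth x i <= b) -> f x <= e.
Proof.
elim: k f => [|k IHk] f.
  by exists (f [tuple]) => x _; rewrite (tuple0 x).
have [F FP] := choice (fun a => IHk (fun x => f [tuple of a :: x])).
have [e eP] := image_bounded F b.
exists e => x xb; rewrite (tuple_eta x).
apply: le_trans (eP _ (xb ord0)); apply: FP => i.
by rewrite tnth_behead; exact: xb.
Qed.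

(* The values are chosen strictly increasing along the lexicographic order of
   the pairs [b <= a], each one above its first coordinate. Regularity bounds
   the values already chosen at every step. *)
Lemma pairing_exists : exists (P : X -> X -> X) (F : X -> X),
  [/\ forall a b, P a b < F a,
      forall a b, b <= a -> a < P a b &
      forall a b a' b', b <= a -> P a b = P a' b' -> a = a' /\ b = b'].
Proof.
have [z0 z0P] := least_exists.
pose R (p q : X * X) := p.2 <= p.1 /\ (p.1 < q.1 \/ p.1 = q.1 /\ p.2 < q.2).
have Rwf : well_founded R.
  case=> a; elim/(well_founded_ind lt_wf): a => a IHa b.
  elim/(well_founded_ind lt_wf): b => b IHb.
  constructor => -[a' b'] [_ /= [a'a|[-> b'b]]]; [exact: IHa | exact: IHb].
have bounded (q : X * X -> X) (a : X) :
    exists c, forall a' b', b' <= a' -> a' <= a -> q (a', b') < c.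
  have [G GP] := choice (fun a' => image_bounded (fun b' => q (a', b')) a').
  have [e eP] := image_bounded G a; have [c ec] := gt_exists e.
  exists c => a' b' b'a' a'a.
  exact: le_lt_trans (le_trans (GP _ _ b'a') (eP _ a'a)) ec.
have step (w : (X * X -> X) * (X * X)) :
    exists c, w.2.1 < c /\ forall p, R p w.2 -> w.1 p < c.
  case: w => q [a b] /=; have [c cP] := bounded q a.
  have [e ae] := gt_exists a; exists (Order.max c e); split.
    by rewrite lt_max ae orbT.
  case=> a' b' [/= b'a' a'a]; rewrite lt_max cP //.
  by case: a'a => [/ltW|[->]].
have [B BP] := choice step.
pose q := Fix Rwf (fun _ => X) (fun p rec => B (fun p' =>
  if pselect (R p' p) is left Rp then rec p' Rp else z0, p)).
have qE p : q p = B (fun p' => if pselect (R p' p) then q p' else z0, p).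
  rewrite /q Fix_eq; first by congr (B (_, _)); apply/funext => p'; case: pselect.
  move=> p' f g fg; congr (B (_, _)); apply/funext => p''.
  by case: pselect.
have q_gt p : p.1 < q p by rewrite qE; exact: (BP (_, _)).1.
have q_mono p p' : R p' p -> q p' < q p.
  move=> Rp; have := (BP (fun p' => if pselect (R p' p) then q p' else z0, p)).2.
  by move=> /(_ p' Rp) /=; rewrite -qE; case: pselect.
have [F FP] := choice (bounded q).
have z0F a : z0 < F a by exact: lt_trans (q_gt (z0, z0)) (FP _ _ _ _ _).
(* Off [b <= a] the value is the least element [z0], which [q (a, b)], being above [a], never
   takes. *)
exists (fun a b => if b <= a then q (a, b) else z0), F; split.
- by move=> a b; case: ifP => // ba; exact: FP.
- by move=> a b ba; rewrite ba; exact: (q_gt (a, b)).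
move=> a b a' b' ba; rewrite ba; case: ifP => [b'a' e|_ e]; last first.
  by have := q_gt (a, b); rewrite /= e ltNge z0P.
have q_lt a1 b1 a2 b2 : b1 <= a1 -> (a1 < a2 \/ a1 = a2 /\ b1 < b2) ->
    q (a1, b1) < q (a2, b2) by move=> le_b lex; exact: q_mono.
case: (ltgtP a a') => [aa'|a'a|eaa].
- by have := q_lt a b a' b' ba (or_introl aa'); rewrite e ltxx.
- by have := q_lt a' b' a b b'a' (or_introl a'a); rewrite e ltxx.
case: (ltgtP b b') => [bb'|b'b|//].
- by have := q_lt a b a' b' ba (or_intror (conj eaa bb')); rewrite e ltxx.
- by have := q_lt a' b' a b b'a' (or_intror (conj (esym eaa) b'b));
    rewrite e ltxx.
Qed.

End RegularCardinal.

(** * Clones containing [T1] are closed downwards *)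

Section ClonesAboveT1.
Variables (d : Order.disp_t) (X : orderType d).
Hypothesis hX : infinite_regular_cardinal X.
Variable C : set (fop X).
Hypotheses (hC : is_clone C) (T1C : forall g, T1 X g -> C (op g)).

Lemma clone_binary (k : nat) (h : X -> X -> X) (F : X -> X) (u v : opn X k) :
  (forall a b, h a b < F a) -> C (op u) -> C (op v) ->
  C (op (fun x => h (u x) (v x))).
Proof.
move=> hF Cu Cv; have [_ _ comp] := hC.
pose g : opn X 2 := fun y => h (tnth y ord0) (tnth y ord_max).
have -> : (fun x => h (u x) (v x)) =
    comp_op g (fun i => if i == ord0 then u else v).
  by apply/funext => x; rewrite /comp_op /g !tnth_mktuple.
apply: comp => [|i]; last by case: ifP.
by apply: T1C; exists F, ord0 => y; exact: hF.
Qed.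

Lemma clone_unary (k : nat) (F : X -> X) (u : opn X k) :
  C (op u) -> C (op (fun x => F (u x))).
Proof.
have [S FS] := choice (fun a => gt_exists hX (F a)) => Cu.
exact: (@clone_binary k (fun a _ => F a) S u u (fun a _ => FS a)).
Qed.

(* Since [u i <= t], the tuple of the [u i] can be coded into a single value by
   packing the [u i] into [t] one after the other: each pairing is almost unary
   because it is only applied on [b <= a]. *)
Lemma clone_determined (k m : nat) (t : opn X k) (u : 'I_m -> opn X k)
    (g : opn X k) :
  C (op t) -> (forall i, C (op (u i))) -> (forall i x, u i x <= t x) ->
  (forall x y, (forall i, u i x = u i y) -> g x = g y) -> C (op g).
Proof.
move=> Ct Cu ut ug; have [P [F [PF P_gt P_inj]]] := pairing_exists hX.
have [z [Cz _ zP]] : exists z : opn X k, [/\ C (op z), forall x, t x <= z x &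
    forall x y, z x = z y -> forall i, i \in enum 'I_m -> u i x = u i y].
  elim: (enum 'I_m) => [|j s [z [Cz tz zP]]]; first by exists t; split.
  have uz x : u j x <= z x by exact: le_trans (ut j x) (tz x).
  exists (fun x => P (z x) (u j x)); split; first exact: clone_binary PF Cz (Cu j).
    by move=> x; apply: le_trans (tz x) (ltW (P_gt _ _ (uz x))).
  move=> x y /(P_inj _ _ _ _ (uz x)) [zxy uxy] i.
  by rewrite inE => /predU1P[->//|]; exact: zP.
have [z0 _] := point_exists hX.
(* [g] is constant on the fibres of [z], so it factors through [z]; off the range of [z] any value
   will do. *)
have decode a : exists b, forall x, z x = a -> g x = b.
  have [[x <-]|na] := pselect (exists x, z x = a).
    by exists (g x) => y zyx; apply: ug => i; rewrite (zP y x) ?mem_enum.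
  by exists z0 => x zxa; case: na; exists x.
have [G GP] := choice decode.
rewrite (_ : g = fun x => G (z x)); first exact: clone_unary.
by apply/funext => x; exact: GP.
Qed.

(* On the region where [x j] is maximal the pairs [P (x j) (x i)] determine [x],
   and they are bounded by a function of [x j]. *)
Lemma clone_restricted (k : nat) (f : opn X k) (j : 'I_k) (c : X) :
  C (op (fun x => if [forall i, tnth x i <= tnth x j] then f x else c)).
Proof.
have [P [F [PF P_gt P_inj]]] := pairing_exists hX.
have [_ Cproj _] := hC.
apply: (@clone_determined k k (fun x => F (tnth x j))
  (fun i x => P (tnth x j) (tnth x i))).
- by apply: (@clone_unary k F (proj_op j)); exact: Cproj.
- by move=> i; apply: (@clone_binary k P F (proj_op j) (proj_op i)).
- by move=> i x; exact/ltW/PF.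
have eq_max x y : (forall i, P (tnth x j) (tnth x i) = P (tnth y j) (tnth y i)) ->
    [forall i, tnth x i <= tnth x j] -> x = y.
  move=> Pxy /forallP xj; apply: eq_from_tnth => i.
  by have [] := P_inj _ _ _ _ (xj i) (Pxy i).
move=> x y Pxy; have Pyx i := esym (Pxy i).
case: ifP => xj; first by move: (xj); rewrite (eq_max x y) // => ->.
by case: ifP => // yj; move: (yj); rewrite (eq_max y x) // xj.
Qed.

(** The regions where the [j]-th entry is largest cover the domain, so [f] is the pointwise maximum
    of its restrictions [u j], extended by the least element. These lie in [C], below [t], and
    determine [f]. *)
Lemma clone_le (k : nat) (f t : opn X k) :
  C (op t) -> (forall x, f x <= t x) -> C (op f).
Proof.
move=> Ct ft; have [c cP] := least_exists hX; have [Cpos _ _] := hC.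
pose u (j : 'I_k) : opn X k :=
  fun x => if [forall i, tnth x i <= tnth x j] then f x else c.
apply: (@clone_determined k k t u) => // [j|j x|].
- exact: clone_restricted.
- by rewrite /u; case: ifP.
have le_f x y : (forall j, u j x = u j y) -> f x <= f y.
  move=> uxy; pose i0 := Ordinal (Cpos _ Ct).
  case: (arg_maxP (fun i => tnth x i) (erefl : xpredT i0)) => j _ xj.
  have := uxy j; rewrite /u ifT; last by apply/forallP => i; exact: xj.
  by move=> ->; case: ifP.
by move=> x y uxy; apply/le_anti; rewrite !le_f.
Qed.
End ClonesAboveT1.

(** * Order properties of the second smallest entry *)

Section SecondSmallest.
Variables (d : Order.disp_t) (X : orderType d) (n : nat) (k : 'I_n).
Hypothesis k1 : k = 1%N :> nat.

Lemma sorting_perm (x : n.-tuple X) : exists p : 'S_n,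
  forall a b : 'I_n, (a <= b)%N -> tnth x (p a) <= tnth x (p b).
Proof.
have /tuple_permP[p xp] : perm_eq (sort <=%O x) x by rewrite perm_sort.
exists p => a b ab; have x0 := tnth x a.
have nthE (i : 'I_n) : tnth x (p i) = nth x0 (sort <=%O x) i.
  by rewrite xp (nth_map i) ?size_enum_ord ?nth_ord_enum.
rewrite !nthE; apply: (sorted_leq_nth le_trans le_refl) => //.
- by rewrite inE size_sort size_tuple.
- by rewrite inE size_sort size_tuple.
Qed.

(** The two smallest entries sit at distinct positions, one of which is not [i]. *)
Lemma mstat_ge_other (x : n.-tuple X) (i : 'I_n) :
  exists2 j, j != i & tnth x j <= mstat k x.
Proof.
have [p xp] := sorting_perm x; rewrite (mstatP k xp).
have [pki|] := eqVneq (p k) i; last by exists (p k).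
have n0 : (0 < n)%N by exact: leq_ltn_trans (ltn_ord k).
exists (p (Ordinal n0)); last exact: xp.
by rewrite -pki (inj_eq perm_inj) -val_eqE /= k1.
Qed.

(** Of two distinct positions, one has rank at least 1 in the sorted order. *)
Lemma mstat_le2 (x : n.-tuple X) (i j : 'I_n) (b : X) :
  i != j -> tnth x i <= b -> tnth x j <= b -> mstat k x <= b.
Proof.
have [p xp] := sorting_perm x; rewrite (mstatP k xp).
wlog le_ji : i j / ((p^-1)%g j <= (p^-1)%g i)%N => [H ij xi xj|].
  by case/orP: (leq_total ((p^-1)%g j) ((p^-1)%g i)) => /H; apply;
    rewrite // eq_sym.
move=> ij xi _; apply: le_trans xi; rewrite -[i in leRHS](permKV p); apply: xp.
rewrite k1; apply: leq_ltn_trans (leq0n ((p^-1)%g j)) _.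
by rewrite ltn_neqAle le_ji andbT val_eqE (inj_eq perm_inj) eq_sym.
Qed.

End SecondSmallest.

(** * The decreasing sequence of clones C_r *)

Section ThresholdClones.
Variables (d : Order.disp_t) (X : orderType d).
Hypothesis hX : infinite_regular_cardinal X.

Definition strong (k : nat) (f : opn X k) (A : pred 'I_k) :=
  forall b, exists e, forall x : k.-tuple X,
    (forall i, A i -> tnth x i <= b) -> f x <= e.

Definition colour_class (k : nat) (c : 'I_k -> nat) (j : 'I_k) : pred 'I_k :=
  fun i => c i == c j.

(** This is C_r in its colouring form. Classes are named by a member [j], so they are never
    empty. *)
Definition thr_clone (r : nat) : set (fop X) :=
  [set f | cloneO X f /\ forall c : 'I_(tag f) -> nat, (forall i, c i < r)%N ->
     exists j, strong (tagged f) (colour_class c j)].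

Lemma strong_sub (k : nat) (f : opn X k) (A B : pred 'I_k) :
  {subset A <= B} -> strong f A -> strong f B.
Proof.
by move=> AB fA b; have [e eP] := fA b; exists e => x xb; apply: eP => i /AB /xb.
Qed.

Lemma strong_comp (k m : nat) (f : opn X k) (g : 'I_k -> opn X m)
    (A : pred 'I_k) (B : pred 'I_m) :
  strong f A -> (forall i, A i -> strong (g i) B) -> strong (comp_op f g) B.
Proof.
move=> fA gB b.
have bound i : exists e, A i -> forall x : m.-tuple X,
    (forall j, B j -> tnth x j <= b) -> g i x <= e.
  have [/gB/(_ b)[e eP]|nAi] := pselect (A i); first by exists e.
  by exists b => /nAi.
have [e eP] := choice bound.
have [e' e'P] := finite_bounded hX e; have [e'' e''P] := fA e'.
exists e'' => x xb; apply: e''P => i Ai; rewrite tnth_mktuple.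
exact: le_trans (eP i Ai x xb) (e'P i).
Qed.

Lemma strong_almost_unary (k : nat) (f : opn X k) :
  almost_unary f <-> exists j, strong f (pred1 j).
Proof.
split=> [[F [j Fj]]|[j fj]].
  exists j => b; have [e eP] := image_bounded hX F b.
  by exists e => x xb; apply/ltW/(lt_le_trans (Fj x))/eP/xb => /=.
have bound b : exists e, forall x : k.-tuple X, tnth x j <= b -> f x < e.
  have [e eP] := fj b; have [e' ee'] := gt_exists hX e.
  by exists e' => x xj; apply: le_lt_trans ee'; apply: eP => i /eqP ->.
by have [F FP] := choice bound; exists F, j => x; exact: FP.
Qed.

Lemma thr_clone_almost_unary (r k : nat) (f : opn X k) :
  almost_unary f -> thr_clone r (op f).
Proof.
move=> /strong_almost_unary[j fj].
split=> [|c _]; first exact: leq_ltn_trans (ltn_ord j).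
by exists j; apply: strong_sub fj => i /eqP ->; rewrite unfold_in /= /colour_class.
Qed.

(** Give each [i] the colour of a class strong for [g i]. In a class strong for [f] under this
    colouring, all [g i] share one strong class. *)
Lemma thr_clone_is_clone (r : nat) : is_clone (thr_clone r).
Proof.
split=> [f []//|n k|n m f g [/= n0 fr] gr].
  apply: thr_clone_almost_unary; apply/strong_almost_unary; exists k => b.
  by exists b => x; apply => /=.
split=> [|/= c cr]; first exact: (gr (Ordinal n0)).1.
have class_g i : exists j : 'I_m, strong (g i) (colour_class c j).
  exact: (gr i).2 c cr.
have [j jP] := choice class_g.
have [i0 fi0] := fr (fun i => c (j i)) (fun i => cr (j i)).
exists (j i0); apply: strong_comp fi0 _ => i /eqP ci.
by have := jP i; rewrite /colour_class ci.
Qed.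

(** By the pigeonhole principle two coordinates share a colour, and bounding both bounds the second
    smallest entry. *)
Lemma thr_clone_mstat (n : nat) (k : 'I_n) :
  k = 1%N :> nat -> thr_clone n.-1 (op (mstat (X := X) k)).
Proof.
move=> k1; have n2 : (1 < n)%N by rewrite -k1.
split=> [|c cr] /=; first exact: ltnW.
suff [i [j [ij cij]]] : exists i j, i != j /\ c i = c j.
  exists j => b; exists b => x xb; apply: (mstat_le2 k1 ij).
    by apply: xb; rewrite /colour_class cij.
  by apply: xb; rewrite /colour_class.
apply: contrapT => nc.
have : injective (fun i => Ordinal (cr i)).
  move=> i j [cij]; apply/eqP; apply: contrapT => /negP ij.
  by apply: nc; exists i, j.
move=> /leq_card; rewrite !card_ord.
by rewrite -ltnS prednK ?ltnn // ltnW.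
Qed.

(** Colour all coordinates differently: with one entry fixed, the value still grows with the
    others. *)
Lemma thr_clone_mstatN (n : nat) (k : 'I_n) :
  k = 1%N :> nat -> ~ thr_clone n (op (mstat (X := X) k)).
Proof.
move=> k1 [_ /(_ (@nat_of_ord n) (@ltn_ord n))] /= [s ks].
have [c0 _] := point_exists hX.
have [e eP] := ks c0; have [e' ee'] := gt_exists hX e.
pose x := [tuple if i == s then c0 else e' | i < n].
have [j js] := mstat_ge_other k1 x s; rewrite tnth_mktuple (negPf js) => e'm.
have : mstat k x <= e by apply: eP => i /eqP/val_inj ->; rewrite tnth_mktuple eqxx.
by rewrite leNgt (lt_le_trans ee' e'm).
Qed.

Lemma thr_cloneS (r : nat) : thr_clone r.+1 `<=` thr_clone r.
Proof.
by move=> f [f0 fr]; split=> // c cr; apply: fr => i; exact: leqW (cr i).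
Qed.

Lemma thr_clone1 : cloneO X = thr_clone 1.
Proof.
apply/seteqP; split=> [[k f] /= k0|f []//]; split=> // c c1 /=.
exists (Ordinal k0) => b; have [e eP] := box_bounded hX f b.
exists e => x xb; apply: eP => i; apply: xb.
apply/eqP; move: (c1 i) (c1 (Ordinal k0)).
by rewrite !ltnS !leqn0 => /eqP -> /eqP ->.
Qed.

(** With as many colours as coordinates, the classes can be made singletons. *)
Lemma bigcap_thr_clone :
  \bigcap_(r in [set r | (0 < r)%N]) thr_clone r = cloneU X.
Proof.
apply/seteqP; split=> [[k f] fr|[k f] [k0 fU] r _]; last first.
  exact: thr_clone_almost_unary.
have [//|k0 _] := fr 1%N; split=> //=; apply/strong_almost_unary.
have [_ /(_ (@nat_of_ord k) (@ltn_ord k))[j fj]] := fr k k0.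
by exists j.
Qed.

(** Binary members of C_2 are almost unary, by the colouring into singletons. Conversely, two weak
    classes yield members of [T1] whose composite with [f] is not almost unary. *)
Lemma thr_clone2 : thr_clone 2 = Pol (T1 X).
Proof.
apply/seteqP; split=> [[k f] fr|[k f] [k0 fP]].
  split=> [|g gT]; first exact: fr.1.
  have [_ _ comp] := thr_clone_is_clone 2.
  have [] := comp _ _ _ g fr (fun i => thr_clone_almost_unary 2 (gT i)).
  move=> _ /(_ (@nat_of_ord 2) (@ltn_ord 2))[j fj]; apply/strong_almost_unary.
  by exists j.
split=> // c c2; apply: contrapT => nc.
have weak s : ~ strong f (fun i => c i == s).
  have [[j <-]|ns] := pselect (exists j, c j = s).
    by move=> fs; apply: nc; exists j.
  move=> fs; apply: nc; exists (Ordinal k0); apply: strong_sub fs => i /eqP cis.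
  by case: ns; exists i.
have unbounded s : exists b, exists w : X -> k.-tuple X,
    forall e, (forall i, c i = s -> tnth (w e) i <= b) /\ e < f (w e).
  apply: contrapT => nb; apply: (weak s) => b; apply: contrapT => ne; apply: nb.
  have total e : exists x : k.-tuple X,
      (forall i, c i = s -> tnth x i <= b) /\ e < f x.
    apply: contrapT => nx; apply: ne; exists e => x xb; rewrite leNgt.
    apply/negP => ex; apply: nx; exists x; split=> // i cis.
    by apply: xb; rewrite cis.
  by have [w wP] := choice total; exists b, w.
have [b0 [w0 w0P]] := unbounded 0%N; have [b1 [w1 w1P]] := unbounded 1%N.
have [z zP] := least_exists hX.
(* [w0 e] and [w1 e] witness that [f] is unbounded while the coordinates of
   colour 0, resp. 1, stay bounded. As [g] runs through [w0] where its first
   argument is [z] and through [w1] where the second is, [g i] is bounded by a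
   function of the first argument if [c i = 0], of the second if [c i = 1]. *)
pose g i : opn X 2 := fun y => if tnth y ord0 == z
  then tnth (w0 (tnth y ord_max)) i else
  if tnth y ord_max == z then tnth (w1 (tnth y ord0)) i else z.
have gT i : T1 X (g i).
  have : (c i == 0%N) || (c i == 1%N) by case: (c i) (c2 i) => [|[]].
  case/orP => /eqP ci.
    have [F FP] := choice (fun a => gt_exists hX (Order.max (tnth (w1 a) i) b0)).
    exists F, ord0 => y; move: (FP (tnth y ord0)); rewrite gt_max => /andP[Fw1 Fb0].
    rewrite /g; case: ifP => _; first exact: le_lt_trans ((w0P _).1 i ci) Fb0.
    by case: ifP => // _; exact: le_lt_trans (zP _) Fb0.
  have [F FP] := choice (fun a => gt_exists hX (Order.max (tnth (w0 a) i) b1)).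
  exists F, ord_max => y; move: (FP (tnth y ord_max)).
  rewrite gt_max => /andP[Fw0 Fb1].
  rewrite /g; case: ifP => // _; case: ifP => _; last exact: le_lt_trans (zP _) Fb1.
  exact: le_lt_trans ((w1P _).1 i ci) Fb1.
have [F [s Fs]] := fP g gT.
(* With [z] at [s] and [e] at the other coordinate, the composite would be below [F z < e], yet it
   equals [f (w0 e)] or [f (w1 e)], which exceed [e]. *)
have [e e_max] := gt_exists hX (Order.max (F z) z).
have {e_max} [Fe ze] : F z < e /\ z < e by apply/andP; rewrite -gt_max.
pose y := [tuple if i == s then z else e | i < 2].
have ys : tnth y s = z by rewrite tnth_mktuple eqxx.
have := Fs y; rewrite ys => yF.
suff : e < comp_op f g y by rewrite ltNge (ltW (lt_trans yF Fe)).
have [s0|s1] : s = ord0 \/ s = ord_max.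
  by case: s {Fs y ys yF} => [[|[]//] p]; [left|right]; apply: val_inj.
  rewrite (_ : comp_op f g y = f (w0 e)); first exact: (w0P e).2.
  congr f; apply: eq_from_tnth => i.
  by rewrite tnth_mktuple /g !tnth_mktuple s0 !eqxx.
rewrite (_ : comp_op f g y = f (w1 e)); first exact: (w1P e).2.
congr f; apply: eq_from_tnth => i.
by rewrite tnth_mktuple /g !tnth_mktuple s1 eqxx /= (gt_eqF ze) eqxx.
Qed.

(** If [D] covered all coordinates, colouring each by a member of [D] containing it would put every
    class inside a weak set. *)
Lemma weak_cover (r m : nat) (f : opn X m) (D : {set {set 'I_m}}) :
  thr_clone r (op f) -> (#|D| <= r)%N ->
  (forall W, W \in D -> ~ strong f [in W]) ->
  exists j, forall W, W \in D -> j \notin W.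
Proof.
move=> fr Dn Dweak; apply: contrapT => nj.
have cover j : exists W, W \in D /\ j \in W.
  apply: contrapT => nW; apply: nj; exists j => W WD; apply/negP => jW.
  by apply: nW; exists W.
have [W WP] := choice cover.
have [_ /(_ (fun j => index (W j) (enum D)))[|j fj]] := fr.
  by move=> j; apply: leq_trans Dn; rewrite cardE index_mem mem_enum;
    exact: (WP j).1.
apply: (Dweak (W j) (WP j).1); apply: strong_sub fj => i /eqP Wij.
have <- : W i = W j.
  by apply: (index_inj (W i) _ _ Wij); rewrite mem_enum; exact: (WP _).1.
exact: (WP i).2.
Qed.

(** * The Baker-Pixley induction *)

Section NearUnanimity.
Variables (n : nat) (k : 'I_n) (C : set (fop X)).
Hypotheses (k1 : k = 1%N :> nat) (hC : is_clone C) (Cm : C (op (mstat k))).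

(* If [n <= #|D|], omitting each of [n] members of [D] in turn gives [n]
   operations, and every member of [D] is handled by all but at most one of
   them, hence by their second smallest value. *)
Lemma weak_cover_bound (m : nat) (f : opn X m) (D : {set {set 'I_m}}) :
  thr_clone n.-1 (op f) -> (forall W, W \in D -> ~ strong f [in W]) ->
  exists t : opn X m, C (op t) /\
    forall W, W \in D -> forall x, exists2 i, i \notin W & tnth x i <= t x.
Proof.
move=> fr; have n2 : (1 < n)%N by rewrite -k1.
have [_ Cproj Ccomp] := hC.
have [N] : exists N, (#|D| <= N)%N by exists #|D|.
(* At most [n.-1] weak sets miss a common coordinate, whose projection is the required term. *)
elim: N D => [|N IHN] D DN Dweak; have [Dn|nD] := leqP #|D| n.-1;
  try by have [j jP] := weak_cover fr Dn Dweak;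
    exists (proj_op j); split=> [|W WD x];
    [exact: Cproj | exists j; [exact: jP|]].
  by move: nD; rewrite ltnNge (leq_trans DN).
have Dn : (n <= #|D|)%N by rewrite -(ltn_predK n2).
pose w (i : 'I_n) : {set 'I_m} := enum_val (widen_ord Dn i).
have wD i : w i \in D by exact: enum_valP.
have smaller i : exists t : opn X m, C (op t) /\ forall W, W \in D :\ w i ->
    forall x, exists2 j, j \notin W & tnth x j <= t x.
  apply: IHN => [|W /setD1P[_]]; last exact: Dweak.
  by rewrite -ltnS; apply: leq_trans DN; rewrite [ltnRHS](cardsD1 (w i)) wD.
have [t tP] := choice smaller.
exists (comp_op (mstat k) t); split=> [|W WD x].
  by apply: Ccomp => // i; exact: (tP i).1.
have [i0 i0P] : exists i0, forall i, i != i0 -> W != w i.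
  have [[i0 ->]|nW] := pselect (exists i0, W = w i0).
    exists i0 => i; apply: contra => /eqP/enum_val_inj/(congr1 val) /= e.
    exact/eqP/val_inj.
  exists k => i _; apply/eqP => Wi; apply: nW; exists i; exact: Wi.
have [i ii0 le_i] := mstat_ge_other k1 [tuple t i x | i < n] i0.
rewrite tnth_mktuple in le_i.
have [|j jW xj] := (tP i).2 W _ x; first by rewrite !inE i0P.
by exists j => //; exact: le_trans xj le_i.
Qed.

Lemma thr_clone_sub :
  (forall g, T1 X g -> C (op g)) -> thr_clone n.-1 `<=` C.
Proof.
move=> T1C [m f] fr.
have [t [Ct tP]] : exists t : opn X m, C (op t) /\
    forall W : {set 'I_m}, ~ strong f [in W] ->
    forall x, exists2 i, i \notin W & tnth x i <= t x.
  pose D := [set W : {set 'I_m} | `[< ~ strong f [in W] >]]%SET.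
  have [|t [Ct tP]] := weak_cover_bound (D := D) fr.
    by move=> W; rewrite inE => /asboolP.
  by exists t; split=> // W nW; apply: tP; rewrite inE; exact/asboolP.
(* One bound serves the finitely many strong sets at once, since the set [A] used below varies with
   [x]. *)
have bound b : exists e, forall A : {set 'I_m}, strong f [in A] ->
    forall x : m.-tuple X, (forall i, i \in A -> tnth x i <= b) -> f x <= e.
  have boundA (A : {set 'I_m}) : exists e, strong f [in A] ->
      forall x : m.-tuple X, (forall i, i \in A -> tnth x i <= b) -> f x <= e.
    have [/(_ b)[e eP]|nA] := pselect (strong f [in A]); last by exists b => /nA.
    by exists e => _ x xb; apply: eP => i; exact: xb.
  have [e eP] := choice boundA; have [e' e'P] := finite_bounded hX e.
  by exists e' => A fA x xb; exact: le_trans (eP A fA x xb) (e'P A).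
have [F FP] := choice bound.
apply: (clone_le hX hC T1C (clone_unary hX hC T1C F Ct)) => x.
pose A := [set i : 'I_m | tnth x i <= t x]%SET.
apply: (FP _ A) => [|i]; last by rewrite inE.
by apply: contrapT => /tP /(_ x)[i]; rewrite inE => /negPf ->.
Qed.

End NearUnanimity.

Lemma cloneM_thr_clone (n : nat) : (1 < n)%N -> cloneM X n = thr_clone n.-1.
Proof.
move=> n2; apply/seteqP; split.
  apply: smallest_sub; first exact: thr_clone_is_clone.
  move=> f [[k /= k1 <-]|[g gT <-]]; first exact: thr_clone_mstat.
  exact: thr_clone_almost_unary.
move=> f fr C [hC genC].
have Cm : C (op (mstat (Ordinal n2))) by apply: genC; left; exists (Ordinal n2).
by apply: (thr_clone_sub _ hC Cm _ fr) => // g gT; apply: genC; right; exists g.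
Qed.

End ThresholdClones.

Theorem theorem38 (d : Order.disp_t) (X : orderType d)
    (hX : infinite_regular_cardinal X) :
  [/\ cloneO X = cloneM X 2,
      cloneM X 3 = Pol (T1 X),
      forall n : nat, (2 <= n)%N -> cloneM X n.+1 `<` cloneM X n &
      \bigcap_(n in [set n : nat | (2 <= n)%N]) cloneM X n = cloneU X].
Proof.
split.
- by rewrite cloneM_thr_clone // thr_clone1.
- by rewrite cloneM_thr_clone // thr_clone2.
- move=> n n2; rewrite !cloneM_thr_clone ?(leqW n2) //=; split.
    by case: n n2 => // n _; exact: thr_cloneS.
  (* The generator m^n_2 itself separates C_(n-1) from C_n. *)
  move=> sub; apply: (@thr_clone_mstatN _ _ hX n (Ordinal n2)) => //.
  by apply: sub; exact: thr_clone_mstat.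
rewrite -bigcap_thr_clone //; apply/seteqP; split=> f fM r /= r0.
  by have := fM r.+1 r0; rewrite cloneM_thr_clone.
by rewrite cloneM_thr_clone //; apply: fM => /=; case: r r0 => [|[]].
Qed.
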